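(* The function $f(x,y,z)=(x^2+y^2+z^2)^{\frac32}$ on $\mathbb{R}^3$ is a solution of the equation $$d\big(\langle df,df\rangle\big)-\Delta(f)\,df=0,$$ where $\Delta=\frac{\partial^2}{\partial x^2}+\frac{\partial^2}{\partial y^2}+\frac{\partial^2}{\partial z^2}$, and consequently the Poisson tensor $(x^2+y^2+z^2)^{\frac12}\,\pi_{so(3)}$, where $$\pi_{so(3)}=z\frac{\partial}{\partial x}\wedge\frac{\partial}{\partial y}-y\frac{\partial}{\partial x}\wedge\frac{\partial}{\partial z}+x\frac{\partial}{\partial y}\wedge\frac{\partial}{\partial z},$$ is compatible with the canonical metric $\langle\cdot,\cdot\rangle$ of $\mathbb{R}^3$.
   Context: The canonical metric of $\mathbb{R}^3$ is regarded as a contravariant metric, i.e. as the scalar product on $T^*\mathbb{R}^3$ with $\langle dx,dx\rangle=\langle dy,dy\rangle=\langle dz,dz\rangle=1$ and $\langle dx,dy\rangle=\langle dx,dz\rangle=\langle dy,dz\rangle=0$. The bivector $\pi_{so(3)}$ is the linear Poisson structure on $\mathbb{R}^3$ corresponding to the Lie algebra $so(3)$. Let $P$ be a manifold with Poisson tensor $\pi$, and let $\langle\cdot,\cdot\rangle$ be a Riemannian metric on $T^*P$ (a smooth symmetric contravariant 2-form that is a scalar product on each $T_x^*P$). The bundle map $\pi:T^*P\to TP$ is given by $\beta[\pi(\alpha)]=\pi(\alpha,\beta)$. The bracket on 1-forms is $[\alpha,\beta]_\pi=L_{\pi(\alpha)}\beta-L_{\pi(\beta)}\alpha-d(\pi(\alpha,\beta))$.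 The Levi-Civita contravariant connection $D$ associated with $(\pi,\langle\cdot,\cdot\rangle)$ is defined, for all $\alpha,\beta,\gamma\in\Omega^1(P)$, by $$2\langle D_\alpha\beta,\gamma\rangle=\pi(\alpha).\langle\beta,\gamma\rangle+\pi(\beta).\langle\alpha,\gamma\rangle-\pi(\gamma).\langle\alpha,\beta\rangle+\langle[\alpha,\beta]_\pi,\gamma\rangle+\langle[\gamma,\alpha]_\pi,\beta\rangle+\langle[\gamma,\beta]_\pi,\alpha\rangle,$$ where $X.g$ denotes the derivative of the function $g$ along the vector field $X$. The Poisson tensor $\pi$ and the metric $\langle\cdot,\cdot\rangle$ are called compatible if for all $\alpha,\beta,\gamma\in\Omega^1(P)$, $$D\pi(\alpha,\beta,\gamma):=\pi(\alpha).\pi(\beta,\gamma)-\pi(D_\alpha\beta,\gamma)-\pi(\beta,D_\alpha\gamma)=0.$$ Regularity convention: the function $(x^2+y^2+z^2)^{3/2}$ is of class $C^2$ on $\mathbb{R}^3$ and the bivector field $(x^2+y^2+z^2)^{1/2}\pi_{so(3)}$ is of class $C^1$ on $\mathbb{R}^3$ (both are smooth away from the origin). The definitions above, which involve only first derivatives of $\pi$, and the Poisson (Jacobi) condition are applied to this $C^1$ bivector field, with $\alpha,\beta,\gamma$ smooth 1-forms. *)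

(* Defs.v *)
From HB Require Import structures.
From mathcomp Require Import all_boot all_order all_algebra.
From mathcomp Require Import all_classical all_reals all_analysis.

Set Implicit Arguments.
Unset Strict Implicit.
Unset Printing Implicit Defensive.

Import Order.TTheory GRing.Theory Num.Theory.
Import numFieldNormedType.Exports.

Local Open Scope ring_scope.

(* Tensor fields on R^3 are given by their components in the coordinates
   (x, y, z): a vector field (resp. a 1-form) is the row of its components on
   d/dx, d/dy, d/dz (resp. dx, dy, dz), and a contravariant 2-tensor is the
   matrix of its values on pairs of coordinate 1-forms. *)
Definition scalar_field (R : realType) : Type := 'rV[R]_3 -> R.
Definition vector_field (R : realType) : Type := 'rV[R]_3 -> 'rV[R]_3.
Definition one_form (R : realType) : Type := 'rV[R]_3 -> 'rV[R]_3.
Definition contra2 (R : realType) : Type := 'rV[R]_3 -> 'M[R]_3.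

Definition xc (R : realType) (p : 'rV[R]_3) : R := p 0 0.
Definition yc (R : realType) (p : 'rV[R]_3) : R := p 0 1.
Definition zc (R : realType) (p : 'rV[R]_3) : R := p 0 2.

Definition e_ (R : realType) (i : 'I_3) : 'rV[R]_3 := delta_mx 0 i.

Definition partial (R : realType) (i : 'I_3) (f : scalar_field R) :
  scalar_field R := fun p => 'D_(e_ R i) f p.

Fixpoint Ck (R : realType) (k : nat) (f : scalar_field R) : Prop :=
  match k with
  | 0 => continuous f
  | k'.+1 => (forall p, differentiable f p) /\ forall i, Ck k' (partial i f)
  end.

Definition smooth (R : realType) (f : scalar_field R) : Prop :=
  forall k, Ck k f.

Definition smooth_form (R : realType) (a : one_form R) : Prop :=
  forall i, smooth (fun p => a p 0 i).

Definition Ck_contra2 (R : realType) (k : nat) (T : contra2 R) : Prop :=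
  forall i j, Ck k (fun p => T p i j).

Definition dext (R : realType) (f : scalar_field R) : one_form R :=
  fun p => \row_i partial i f p.

Definition laplacian (R : realType) (f : scalar_field R) : scalar_field R :=
  fun p => \sum_i partial i (partial i f) p.

(* [act X g] is X.g. *)
Definition act (R : realType) (X : vector_field R) (g : scalar_field R) :
  scalar_field R := fun p => 'D_(X p) g p.

Definition eval2 (R : realType) (T : contra2 R) (a b : one_form R) :
  scalar_field R := fun p => (a p *m T p *m (b p)^T) 0 0.

(* (L_X b)_j = X.b_j + sum_i b_i (d_j X_i) *)
Definition lie (R : realType) (X : vector_field R) (b : one_form R) :
  one_form R :=
  fun p => \row_j (act X (fun q => b q 0 j) p
                   + \sum_i b p 0 i * partial j (fun q => X q 0 i) p).

(* The bundle map T^*P -> TP, characterised by b[pi(a)] = pi(a, b). *)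
Definition sharp (R : realType) (pi : contra2 R) (a : one_form R) :
  vector_field R := fun p => a p *m pi p.

Definition bracket (R : realType) (pi : contra2 R) (a b : one_form R) :
  one_form R :=
  fun p => lie (sharp pi a) b p - lie (sharp pi b) a p - dext (eval2 pi a b) p.

Definition is_levi_civita (R : realType) (pi g : contra2 R)
    (D : one_form R -> one_form R -> one_form R) : Prop :=
  forall a b c : one_form R,
    smooth_form a -> smooth_form b -> smooth_form c ->
    forall p : 'rV[R]_3,
      2 * eval2 g (D a b) c p =
        act (sharp pi a) (eval2 g b c) p
      + act (sharp pi b) (eval2 g a c) p
      - act (sharp pi c) (eval2 g a b) p
      + eval2 g (bracket pi a b) c p
      + eval2 g (bracket pi c a) b p
      + eval2 g (bracket pi c b) a p.

Definition Dpi (R : realType) (pi : contra2 R)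
    (D : one_form R -> one_form R -> one_form R) (a b c : one_form R) :
  scalar_field R :=
  fun p => act (sharp pi a) (eval2 pi b c) p
           - eval2 pi (D a b) c p - eval2 pi b (D a c) p.

(* Taking c = dx, dy, dz in [is_levi_civita] determines D on smooth 1-forms
   when g is nondegenerate, so the existential picks out the Levi-Civita
   contravariant connection.  Its values D a b are only continuous when pi is
   of class C^1, and they are not differentiated in [Dpi]. *)
Definition compatible (R : realType) (pi g : contra2 R) : Prop :=
  exists D, is_levi_civita pi g D /\
    forall a b c : one_form R,
      smooth_form a -> smooth_form b -> smooth_form c ->
      forall p, Dpi pi D a b c p = 0.

Definition poisson_bracket (R : realType) (pi : contra2 R)
    (f h : scalar_field R) : scalar_field R :=
  eval2 pi (dext f) (dext h).

(* C^1 regularity suffices: {g, h} is then of class C^1 for smooth g, h. *)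
Definition is_poisson (R : realType) (pi : contra2 R) : Prop :=
  [/\ Ck_contra2 1 pi,
      forall p, (pi p)^T = - pi p &
      forall f g h : scalar_field R, smooth f -> smooth g -> smooth h ->
      forall p, poisson_bracket pi f (poisson_bracket pi g h) p
                + poisson_bracket pi g (poisson_bracket pi h f) p
                + poisson_bracket pi h (poisson_bracket pi f g) p = 0].

(* Gram matrix of (dx, dy, dz). *)
Definition canonical_metric (R : realType) : contra2 R := fun _ => 1%:M.

(* (X /\ Y)(a, b) = a(X) b(Y) - a(Y) b(X) *)
Definition wedge (R : realType) (X Y : 'rV[R]_3) : 'M[R]_3 :=
  X^T *m Y - Y^T *m X.

Definition pi_so3 (R : realType) : contra2 R :=
  fun p => zc p *: wedge (e_ R 0) (e_ R 1)
           - yc p *: wedge (e_ R 0) (e_ R 2)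
           + xc p *: wedge (e_ R 1) (e_ R 2).

(* Main.v *)
(* Write f = r^3 and V = grad f / 3 = r (x, y, z).  The bivector is
   pi(a, b) = (V x a) . b, and V is of class C^1 on all of R^3: at the origin
   its components are O(r^2), and its Jacobian r I + p^T p / r tends to 0.

   For any bivector of this form, with V differentiable, the Levi-Civita
   contravariant connection of the Euclidean metric is
   D_a b = (V x a).b + (div V / 2 a - (a . grad) V) x b.  If moreover the
   Jacobian H of V is symmetric, then
   D pi(a, b, c) = 1/2 (b x c) . (a x (2 H V - tr(H) V)),
   and 2 H V - tr(H) V is proportional to d<df, df> - Delta(f) df.  The Jacobi
   identity reduces to V . curl V = 0, by symmetry of second derivatives of the
   (smooth) arguments. *)

From HB Require Import structures.
Require Import Defs.
From mathcomp Require Import all_boot all_order all_algebra.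
From mathcomp Require Import all_classical all_reals all_analysis.
From mathcomp Require Import ring.
Import Order.TTheory GRing.Theory Num.Theory.
Import numFieldNormedType.Exports.
Local Open Scope ring_scope.

(** * Vector algebra in dimension three *)

Lemma ord3P (P : 'I_3 -> Prop) : P 0 -> P 1 -> P 2 -> forall i, P i.
Proof.
by move=> P0 P1 P2 [[|[|[|//]]] i3];
  [move: P0|move: P1|move: P2]; congr P; apply: val_inj.
Qed.

Lemma big_ord3 (V : nmodType) (F : 'I_3 -> V) :
  \sum_i F i = F 0 + F 1 + F 2.
Proof.
rewrite !big_ord_recl big_ord0 addr0 addrA.
by congr (_ + F _ + F _); apply: val_inj.
Qed.

(** With matrix entries turned into variables, [ring] and [field] see a plain identity between
    atoms. *)
Ltac generalize_entries :=
  repeat match goal with |- context [fun_of_matrix ?M ?i ?j] =>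
    generalize (fun_of_matrix M i j) end.

Section Vectors.
Context {R : realType}.
Implicit Types u v w : 'rV[R]_3.

Definition dotv u v : R := \sum_i u 0 i * v 0 i.

(** Indices in ['I_3] add modulo 3, so one cyclic formula covers the three components. *)
Definition crossv u v : 'rV[R]_3 :=
  \row_i (u 0 (i + 1) * v 0 (i + 2) - u 0 (i + 2) * v 0 (i + 1)).

(** This is [pi_so3] with [v] in place of [(x, y, z)]. It is linear in [v], which lets the factor
    [r] pass inside. *)
Definition cross_mx v : 'M[R]_3 :=
  v 0 2 *: wedge (e_ R 0) (e_ R 1) - v 0 1 *: wedge (e_ R 0) (e_ R 2)
  + v 0 0 *: wedge (e_ R 1) (e_ R 2).

Lemma dotvE u v : dotv u v = u 0 0 * v 0 0 + u 0 1 * v 0 1 + u 0 2 * v 0 2.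
Proof. exact: big_ord3. Qed.

Lemma dotvC u v : dotv u v = dotv v u.
Proof. by apply: eq_bigr => i _; rewrite mulrC. Qed.

Lemma dotv_e u i : dotv u (e_ R i) = u 0 i.
Proof.
rewrite /dotv (bigD1 i)//= big1 ?addr0 ?mxE ?eqxx ?mulr1// => j /negbTE ji.
by rewrite mxE eqxx ji mulr0.
Qed.

Lemma crossv0 u v : crossv u v 0 0 = u 0 1 * v 0 2 - u 0 2 * v 0 1.
Proof. by rewrite mxE; congr (u 0 _ * v 0 _ - u 0 _ * v 0 _); apply: val_inj. Qed.

Lemma crossv1 u v : crossv u v 0 1 = u 0 2 * v 0 0 - u 0 0 * v 0 2.
Proof. by rewrite mxE; congr (u 0 _ * v 0 _ - u 0 _ * v 0 _); apply: val_inj. Qed.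

Lemma crossv2 u v : crossv u v 0 2 = u 0 0 * v 0 1 - u 0 1 * v 0 0.
Proof. by rewrite mxE; congr (u 0 _ * v 0 _ - u 0 _ * v 0 _); apply: val_inj. Qed.

Definition crossvE := (crossv0, crossv1, crossv2).


Lemma mulmx_cross_mx u v : u *m cross_mx v = crossv v u.
Proof.
by apply/rowP; apply: ord3P; rewrite ?crossvE mxE big_ord3 !mxE !big_ord1 !mxE /=;
  generalize_entries; intros; ring.
Qed.

Lemma tr_wedge u v : (wedge u v)^T = - wedge u v.
Proof. by rewrite /wedge raddfB /= !trmx_mul !trmxK opprB. Qed.

Lemma tr_cross_mx v : (cross_mx v)^T = - cross_mx v.
Proof.
rewrite /cross_mx raddfD raddfB /= ![(_ *: wedge _ _)^T]linearZ /= !tr_wedge.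
by rewrite !scalerN opprD opprB opprK [- _ + _]addrC.
Qed.
End Vectors.

(** * Derivatives of fields and the connection of a cross-product bivector *)

Lemma deriveE_partial (R : realType) (g : scalar_field R) (p v : 'rV[R]_3) :
  differentiable g p -> 'D_v g p = \sum_i v 0 i * partial i g p.
Proof.
move=> dg; rewrite deriveE// {1}[v]row_sum_delta raddf_sum/=.
by apply: eq_bigr => i _; rewrite linearZ /= /partial deriveE.
Qed.

(* Locked: otherwise failed unifications unfold the underlying limits. *)
HB.lock Definition dfield {R : realType} (v : 'rV[R]_3) (X : vector_field R)
  (p : 'rV[R]_3) : 'rV[R]_3 := \row_i 'D_v (fun q => X q 0 i) p.

Section FieldDerivative.
Context {R : realType}.
Implicit Types (X Y : vector_field R) (p v : 'rV[R]_3).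

Definition differentiable_field X p :=
  forall i, differentiable (fun q => X q 0 i) p.

Lemma dfieldE v X p i : dfield v X p 0 i = 'D_v (fun q => X q 0 i) p.
Proof. by rewrite dfield.unlock mxE. Qed.

(** Brings every directional derivative down to Jacobian entries, after which the tensor identities
    become polynomial. *)
Lemma dfield_sum v X p i : differentiable_field X p ->
  dfield v X p 0 i = \sum_j v 0 j * dfield (e_ R j) X p 0 i.
Proof.
move=> dX; rewrite dfieldE deriveE_partial//.
by apply: eq_bigr => j _; rewrite dfieldE.
Qed.

Lemma is_derive_field {v X p} i : differentiable_field X p ->
  is_derive p v (fun q => X q 0 i) (dfield v X p 0 i).
Proof. by move=> dX; rewrite dfieldE; apply/derivableP/diff_derivable. Qed.

Lemma differentiable_dotv X Y p :
  differentiable_field X p -> differentiable_field Y p ->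
  differentiable (fun q => dotv (X q) (Y q)) p.
Proof.
move=> dX dY; rewrite (_ : (fun q => _) =
    \sum_i ((fun q => X q 0 i) * (fun q => Y q 0 i))).
  by apply: differentiable_sum => i; apply: differentiableM.
by apply/funext => q; rewrite fct_sumE.
Qed.

Lemma derive_dotv v X Y p :
  differentiable_field X p -> differentiable_field Y p ->
  'D_v (fun q => dotv (X q) (Y q)) p =
  dotv (dfield v X p) (Y p) + dotv (X p) (dfield v Y p).
Proof.
move=> dX dY; rewrite (_ : (fun q => _) =
    \sum_i ((fun q => X q 0 i) * (fun q => Y q 0 i))); last first.
  by apply/funext => q; rewrite fct_sumE.
(* From these instances [derive_val] computes the derivative of the sum of products. *)
have dXi i := is_derive_field (v := v) i dX.
have dYi i := is_derive_field (v := v) i dY.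
rewrite derive_val -big_split /=; apply: eq_bigr => i _.
by rewrite addrC; congr (_ + _); exact: mulrC.
Qed.

Lemma differentiable_crossv X Y p :
  differentiable_field X p -> differentiable_field Y p ->
  differentiable_field (fun q => crossv (X q) (Y q)) p.
Proof.
move=> dX dY i; rewrite (_ : (fun q => _) =
    (fun q => X q 0 (i + 1)) * (fun q => Y q 0 (i + 2)) -
    (fun q => X q 0 (i + 2)) * (fun q => Y q 0 (i + 1))).
  by apply: differentiableB; apply: differentiableM.
by apply/funext => q; rewrite mxE.
Qed.

Lemma dfield_crossv v X Y p i :
  differentiable_field X p -> differentiable_field Y p ->
  dfield v (fun q => crossv (X q) (Y q)) p 0 i =
  crossv (dfield v X p) (Y p) 0 i + crossv (X p) (dfield v Y p) 0 i.
Proof.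
move=> dX dY; rewrite dfieldE (_ : (fun q => _) =
    (fun q => X q 0 (i + 1)) * (fun q => Y q 0 (i + 2)) -
    (fun q => X q 0 (i + 2)) * (fun q => Y q 0 (i + 1))); last first.
  by apply/funext => q; rewrite mxE.
have dXi j := is_derive_field (v := v) j dX.
have dYi j := is_derive_field (v := v) j dY.
rewrite derive_val ![crossv _ _ 0 i]mxE /GRing.scale /=.
by generalize_entries; intros; ring.
Qed.

End FieldDerivative.

(** * Bracket, connection and Jacobi sum of the bivector [(V x a) . b] *)

Section CrossBivector.
Context {R : realType} (V : vector_field R).
Implicit Types (a b c : one_form R) (p : 'rV[R]_3).

Let pi : contra2 R := fun p => cross_mx (V p).

Lemma eval2_canonical a b :
  eval2 (@canonical_metric R) a b = fun p => dotv (a p) (b p).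
Proof.
apply/funext => p; rewrite /eval2 /canonical_metric mulmx1 mxE.
by apply: eq_bigr => i _; rewrite mxE.
Qed.

Lemma sharp_cross a : sharp pi a = fun p => crossv (V p) (a p).
Proof. by apply/funext => p; rewrite /sharp mulmx_cross_mx. Qed.

Lemma eval2_cross a b :
  eval2 pi a b = fun p => dotv (crossv (V p) (a p)) (b p).
Proof.
apply/funext => p; rewrite /eval2 mulmx_cross_mx mxE.
by apply: eq_bigr => i _; congr (_ * _); rewrite mxE.
Qed.

Lemma lieE (X : vector_field R) b p :
  lie X b p = \row_j (dfield (X p) b p 0 j + dotv (b p) (dfield (e_ R j) X p)).
Proof.
apply/rowP => j; rewrite !mxE dfieldE; congr (_ + _).
by apply: eq_bigr => i _; rewrite dfieldE.
Qed.

Hypothesis dV : forall p, differentiable_field V p.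

Definition cross_bracket a b p : 'rV[R]_3 :=
  \row_j (dfield (crossv (V p) (a p)) b p 0 j
          - dfield (crossv (V p) (b p)) a p 0 j
          + dotv (crossv (dfield (e_ R j) V p) (a p)) (b p)).

Lemma cross_bracketE a b p j : cross_bracket a b p 0 j =
  dfield (crossv (V p) (a p)) b p 0 j - dfield (crossv (V p) (b p)) a p 0 j
  + dotv (crossv (dfield (e_ R j) V p) (a p)) (b p).
Proof. exact: mxE. Qed.

(** The terms where [d_j] falls on [a] or [b] cancel between the Lie derivatives and the exact term.
    The three terms in [d_j V] are equal up to sign, by antisymmetry of the triple product, and add
    up to one. *)
Lemma bracket_cross a b p :
  differentiable_field a p -> differentiable_field b p ->
  bracket pi a b p = cross_bracket a b p.
Proof.
move=> da db; rewrite /bracket !sharp_cross !lieE eval2_cross /dext /partial.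
apply/rowP => j; rewrite !mxE derive_dotv//; last exact: differentiable_crossv.
rewrite !dotvE !dfield_crossv// !crossvE.
by generalize_entries; intros; ring.
Qed.

Lemma act_canonical a b c p :
  differentiable_field b p -> differentiable_field c p ->
  act (sharp pi a) (eval2 (@canonical_metric R) b c) p =
  dotv (dfield (crossv (V p) (a p)) b p) (c p)
  + dotv (b p) (dfield (crossv (V p) (a p)) c p).
Proof.
by move=> db dc; rewrite eval2_canonical sharp_cross; exact: derive_dotv.
Qed.

(* The Koszul formula gives D_a b = (V x a).b + w(a) x b, where
   w(a) = (div V / 2) a - (a . grad) V is [connection_rotation]. *)
Definition divergence p : R := \sum_i dfield (e_ R i) V p 0 i.

Definition connection_rotation a : vector_field R := fun p =>
  \row_i (2^-1 * divergence p * a p 0 i - dfield (a p) V p 0 i).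

Definition cross_connection a b : one_form R := fun p =>
  \row_i (dfield (crossv (V p) (a p)) b p 0 i
          + crossv (connection_rotation a p) (b p) 0 i).

Lemma connection_rotationE a p i : connection_rotation a p 0 i =
  2^-1 * divergence p * a p 0 i - dfield (a p) V p 0 i.
Proof. exact: mxE. Qed.

Lemma cross_connectionE a b p i : cross_connection a b p 0 i =
  dfield (crossv (V p) (a p)) b p 0 i
  + crossv (connection_rotation a p) (b p) 0 i.
Proof. exact: mxE. Qed.

(** The derivatives of [a], [b], [c] add up to twice [(V x a).b] paired with [c]. The terms in the
    Jacobian of [V] are handled by the identity [det(X,a,b) c + det(X,b,c) a + det(X,c,a) b =
    det(a,b,c) X]: with [X = d_j V], its [j]-th components sum to [div V det(a,b,c)]. *)
Lemma cross_connection_koszul (a b c : one_form R) p :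
    differentiable_field a p -> differentiable_field b p ->
    differentiable_field c p ->
  2 * eval2 (@canonical_metric R) (cross_connection a b) c p =
    act (sharp pi a) (eval2 (@canonical_metric R) b c) p
    + act (sharp pi b) (eval2 (@canonical_metric R) a c) p
    - act (sharp pi c) (eval2 (@canonical_metric R) a b) p
    + eval2 (@canonical_metric R) (bracket pi a b) c p
    + eval2 (@canonical_metric R) (bracket pi c a) b p
    + eval2 (@canonical_metric R) (bracket pi c b) a p.
Proof.
move=> da db dc.
have metric_bracket x y z : differentiable_field x p -> differentiable_field y p ->
    eval2 (@canonical_metric R) (bracket pi x y) z p
    = dotv (cross_bracket x y p) (z p).
  by move=> dx dy; rewrite eval2_canonical -bracket_cross.
transitivity (2 * dotv (cross_connection a b p) (c p)).
  by rewrite eval2_canonical.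
symmetry; transitivity
  (dotv (dfield (crossv (V p) (a p)) b p) (c p)
    + dotv (b p) (dfield (crossv (V p) (a p)) c p)
   + (dotv (dfield (crossv (V p) (b p)) a p) (c p)
    + dotv (a p) (dfield (crossv (V p) (b p)) c p))
   - (dotv (dfield (crossv (V p) (c p)) a p) (b p)
    + dotv (a p) (dfield (crossv (V p) (c p)) b p))
   + dotv (cross_bracket a b p) (c p)
   + dotv (cross_bracket c a p) (b p)
   + dotv (cross_bracket c b p) (a p)).
  congr (_ + _ - _ + _ + _ + _);
  [exact: act_canonical|exact: act_canonical|exact: act_canonical
  |exact: metric_bracket..].
rewrite !dotvE !cross_bracketE.
rewrite !cross_connectionE !crossvE !connection_rotationE !dotvE !crossvE.
rewrite !(dfield_sum (a p))// /divergence !big_ord3.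
(* Trading one diagonal entry for the half divergence [h] removes [2^-1], so that [ring]
   suffices. *)
move: (dfield (e_ R 0) V p 0 0) => d00.
pose h := 2^-1 * (d00 + dfield (e_ R 1) V p 0 1 + dfield (e_ R 2) V p 0 2).
rewrite -/h (_ : d00 = 2 * h - dfield (e_ R 1) V p 0 1 - dfield (e_ R 2) V p 0 2);
  last by rewrite /h; field.
move: h; generalize_entries; intros.
by ring.
Qed.

Lemma derive_eval2_cross v a b p :
  differentiable_field a p -> differentiable_field b p ->
  'D_v (eval2 pi a b) p = dotv (crossv (dfield v V p) (a p)) (b p)
    + dotv (crossv (V p) (dfield v a p)) (b p)
    + dotv (crossv (V p) (a p)) (dfield v b p).
Proof.
move=> da db; rewrite eval2_cross derive_dotv//; last exact: differentiable_crossv.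
congr (_ + _); rewrite !dotvE !dfield_crossv// !mulrDl.
by ring.
Qed.

(** When [df = 3 V] and the Jacobian of [V] is symmetric, this is one ninth of
    [d<df, df> - Delta(f) df]. *)
Definition compatibility_defect p : 'rV[R]_3 :=
  \row_i (2 * dfield (V p) V p 0 i - divergence p * V p 0 i).

Lemma compatibility_defectE p i : compatibility_defect p 0 i =
  2 * dfield (V p) V p 0 i - divergence p * V p 0 i.
Proof. exact: mxE. Qed.

(** The derivatives of [b] and [c] cancel by the Leibniz rule. Since the cross product with
    [w = w(a)] is a derivation of the triple product, what remains is
    [(b x c) . ((V x a).V + w x V)]. For a symmetric Jacobian [H], the identity [H(V x a) + HV x a +
    V x Ha = tr(H) (V x a)] then gives the right-hand side. *)
Lemma Dpi_cross_connection a b c p :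
    differentiable_field a p -> differentiable_field b p ->
    differentiable_field c p ->
    (forall i j, dfield (e_ R i) V p 0 j = dfield (e_ R j) V p 0 i) ->
  Dpi pi cross_connection a b c p =
  2^-1 * dotv (crossv (b p) (c p)) (crossv (a p) (compatibility_defect p)).
Proof.
move=> da db dc symV.
have evalE x y : eval2 pi x y p = dotv (crossv (V p) (x p)) (y p).
  by rewrite eval2_cross.
transitivity
   (dotv (crossv (dfield (crossv (V p) (a p)) V p) (b p)) (c p)
    + dotv (crossv (V p) (dfield (crossv (V p) (a p)) b p)) (c p)
    + dotv (crossv (V p) (b p)) (dfield (crossv (V p) (a p)) c p)
    - dotv (crossv (V p) (cross_connection a b p)) (c p)
    - dotv (crossv (V p) (b p)) (cross_connection a c p)).
  rewrite /Dpi; congr (_ - _ - _); [|exact: evalE..].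
  by rewrite sharp_cross; apply: derive_eval2_cross.
rewrite !dotvE !crossvE !compatibility_defectE.
rewrite !cross_connectionE !crossvE !connection_rotationE.
rewrite !(dfield_sum (a p))// !(dfield_sum (V p))// !(dfield_sum (crossv _ _) V)//.
rewrite /divergence !big_ord3 !crossvE.
rewrite (symV 1 0) (symV 2 0) (symV 2 1).
generalize_entries; intros.
by field.
Qed.

(** Expanded form of [pi(a, d(pi(b, c)))], that is [{f, {g, h}}] for the exact forms [df], [dg],
    [dh]. *)
Definition iterated_bracket a b c p : R :=
  \sum_i crossv (V p) (a p) 0 i *
    (dotv (crossv (dfield (e_ R i) V p) (b p)) (c p)
     + dotv (crossv (V p) (dfield (e_ R i) b p)) (c p)
     + dotv (crossv (V p) (b p)) (dfield (e_ R i) c p)).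

Lemma eval2_dext_cross a b c p :
  differentiable_field b p -> differentiable_field c p ->
  eval2 pi a (dext (eval2 pi b c)) p = iterated_bracket a b c p.
Proof.
move=> db dc; rewrite eval2_cross; apply: eq_bigr => i _; congr (_ * _).
by rewrite mxE -derive_eval2_cross.
Qed.

(* For general V the cyclic sum is V . curl V times det(a, b, c), up to sign. *)
Lemma iterated_bracket_cyclic a b c p :
    (forall i j, dfield (e_ R i) a p 0 j = dfield (e_ R j) a p 0 i) ->
    (forall i j, dfield (e_ R i) b p 0 j = dfield (e_ R j) b p 0 i) ->
    (forall i j, dfield (e_ R i) c p 0 j = dfield (e_ R j) c p 0 i) ->
    (forall i j, dfield (e_ R i) V p 0 j = dfield (e_ R j) V p 0 i) ->
  iterated_bracket a b c p + iterated_bracket b c a p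
  + iterated_bracket c a b p = 0.
Proof.
move=> syma symb symc symV.
rewrite /iterated_bracket !big_ord3 !dotvE !crossvE.
rewrite (symV 1 0) (symV 2 0) (symV 2 1) (syma 1 0) (syma 2 0) (syma 2 1).
rewrite (symb 1 0) (symb 2 0) (symb 2 1) (symc 1 0) (symc 2 0) (symc 2 1).
by generalize_entries; intros; ring.
Qed.
End CrossBivector.

(** * Symmetry of second derivatives *)

Section MixedDerivatives.
Context {R : realType} {W : normedModType R}.
Implicit Types (f : W -> R) (p x u w : W).

Lemma is_derive_line f x u (s : R) : derivable f (x + s *: u) u ->
  is_derive s 1 (fun r : R => f (x + r *: u)) ('D_u f (x + s *: u)).
Proof.
(* The two difference quotients are the same function, so derivability and value transfer
   together. *)
have E : (fun h : R => h^-1 *: (((fun r : R => f (x + r *: u)) \o shift s) (h *: 1)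
      - f (x + s *: u)))
    = (fun h : R => h^-1 *: ((f \o shift (x + s *: u)) (h *: u) - f (x + s *: u))).
  apply/funext => h /=; rewrite [h *: 1]mulr1 scalerDl.
  by rewrite addrCA.
by move=> df; split; rewrite /derivable /derive E.
Qed.

Lemma MVT_line f x u (t : R) : 0 < t -> (forall y, derivable f y u) ->
  exists2 c, 0 < c < t & f (x + t *: u) - f x = t * 'D_u f (x + c *: u).
Proof.
move=> t0 df.
have dl s := @is_derive_line f x u s (df _).
have [|c] := @MVT R (fun r : R => f (x + r *: u)) _ 0 t t0 (fun s _ => dl s).
  by apply: derivable_within_continuous => s _; exact: ex_derive.
by rewrite in_itv /= scale0r addr0 subr0 mulrC => ct ->; exists c.
Qed.

Definition second_difference f p u w : R :=
  f (p + u + w) - f (p + u) - (f (p + w) - f p).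

Lemma second_differenceC f p u w :
  second_difference f p u w = second_difference f p w u.
Proof. by rewrite /second_difference -!addrA [w + u]addrC; ring. Qed.

(** The second difference is the increment along [t u] of [g y = f (y + t w) - f y]. The mean value
    theorem is applied to [g], then to ['D_u f] along [w]. *)
Lemma second_difference_MVT f p u w (t : R) : 0 < t ->
    (forall y, derivable f y u) -> (forall y, derivable ('D_u f) y w) ->
  exists c d, [/\ 0 < c < t, 0 < d < t &
    second_difference f p (t *: u) (t *: w) =
    t ^+ 2 * 'D_w ('D_u f) (p + c *: u + d *: w)].
Proof.
move=> t0 df ddf.
pose g y := f (y + t *: w) - f y.
have dg y : is_derive y u g ('D_u f (y + t *: w) - 'D_u f y).
  have dshift : is_derive y u (fun y => f (y + t *: w)) ('D_u f (y + t *: w)).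
    have E : (fun h : R => h^-1 *: (((fun y => f (y + t *: w)) \o shift y) (h *: u)
        - f (y + t *: w)))
      = (fun h : R => h^-1 *: ((f \o shift (y + t *: w)) (h *: u) - f (y + t *: w))).
      by apply/funext => h /=; rewrite addrA.
    by split; rewrite /derivable /derive E//; exact: df.
  by apply: is_deriveB; exact/derivableP.
have [|c ct gE] := @MVT_line g p u t t0; first by move=> y; exact: ex_derive.
have [d dt dE] := @MVT_line ('D_u f) (p + c *: u) w t t0 ddf.
exists c, d; split=> //.
by move: gE; rewrite derive_val dE /g /second_difference => ->; ring.
Qed.

(** Schwarz's theorem: the second difference is symmetric in [u] and [w], so the two mixed
    derivatives agree at two points that are arbitrarily close to [p], and continuity at [p]
    concludes. *)
Lemma derive_comm f p u w :
    (forall y, derivable f y u) -> (forall y, derivable f y w) ->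
    (forall y, derivable ('D_u f) y w) -> (forall y, derivable ('D_w f) y u) ->
    {for p, continuous ('D_w ('D_u f))} -> {for p, continuous ('D_u ('D_w f))} ->
  'D_w ('D_u f) p = 'D_u ('D_w f) p.
Proof.
move=> dfu dfw dfuw dfwu cuw cwu.
apply/eqP; rewrite -subr_eq0 -normr_le0; apply/ler_addgt0Pl => e e0; rewrite addr0.
have triangle (a b c : R) : `|a - c| < e / 2 -> `|b - c| < e / 2 -> `|a - b| <= e.
  move=> ac bc; rewrite (splitr e) (le_trans (ler_distD c _ _))// lerD ?ltW//.
  by rewrite distrC.
have e2 : 0 < e / 2 by rewrite divr_gt0.
move/cvgrPdist_lt : cuw => /(_ _ e2) /nbhs_ballP[r1 /= r10 near1].
move/cvgrPdist_lt : cwu => /(_ _ e2) /nbhs_ballP[r2 /= r20 near2].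
(* With [t = min(r1, r2) / M], both intermediate points lie in the two balls; the [1] keeps [M]
   positive when [u = w = 0]. *)
pose M : R := `|u| + `|w| + 1.
have M0 : 0 < M by rewrite ltr_wpDl// addr_ge0.
pose t := Num.min r1 r2 / M.
have t0 : 0 < t by rewrite divr_gt0// lt_min r10.
have close c d : 0 < c < t -> 0 < d < t -> `|c *: u + d *: w| < Num.min r1 r2.
  move=> /andP[c0 ct] /andP[d0 dt].
  have -> : Num.min r1 r2 = t * M by rewrite divfK// gt_eqF.
  rewrite (le_lt_trans (ler_normD _ _))// !normrZ !gtr0_norm// /M.
  by rewrite mulrDr mulr1 -[ltLHS]addr0 ler_ltD// mulrDr lerD// ler_wpM2r// ltW.
have [c [d [ct dt E1]]] := @second_difference_MVT f p u w t t0 dfu dfuw.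
have [d' [c' [dt' ct' E2]]] := @second_difference_MVT f p w u t t0 dfw dfwu.
have E : 'D_w ('D_u f) (p + c *: u + d *: w) =
         'D_u ('D_w f) (p + d' *: w + c' *: u).
  apply: (@mulfI _ (t ^+ 2)); first by rewrite expf_neq0// gt_eqF.
  exact: etrans (esym E1) (etrans (second_differenceC _ _ _ _) E2).
have b1 : `|'D_w ('D_u f) p - 'D_w ('D_u f) (p + c *: u + d *: w)| < e / 2.
  apply: near1; rewrite -ball_normE /= -addrA opprD addNKr normrN.
  by have := close _ _ ct dt; rewrite lt_min => /andP[].
have b2 : `|'D_u ('D_w f) p - 'D_u ('D_w f) (p + d' *: w + c' *: u)| < e / 2.
  apply: near2; rewrite -ball_normE /= -addrA opprD addNKr normrN addrC.
  by have := close _ _ ct' dt'; rewrite lt_min => /andP[].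
rewrite -E in b2.
exact: (triangle _ _ _ b1 b2).
Qed.

End MixedDerivatives.

(** * The field r (x, y, z) *)

(** The bound makes [f] a little-o of the identity at 0, so the zero map is its differential. This
    serves at the origin, where the product rule fails because [radius] is not differentiable. *)
Lemma diff0_bound {R : realType} {W : normedModType R} (f g : W -> R) :
    f 0 = 0 -> (forall h, `|f h| <= g h * `|h|) ->
    {for 0, continuous g} -> g 0 = 0 ->
  differentiable f 0 /\ 'd f 0 = (fun=> 0) :> (W -> R).
Proof.
move=> f0 fg gc g0.
have fo : f \o shift 0 = cst (f 0) + (\0 : W -> R) +o_ 0 id.
  apply/eqaddoP => e e0.
  move/cvgrPdist_le : gc => /(_ _ e0); rewrite g0; apply: filterS => h gh.
  rewrite !fctE /= f0 !addr0 subr0 (le_trans (fg h))// ler_wpM2r//.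
  by rewrite (le_trans (ler_norm _))// -normrN -sub0r.
have df : 'd f 0 = \0 :> (W -> R).
  by apply: diff_unique fo; exact: cst_continuous.
split=> //; apply/diff_locallyP; rewrite df; split=> //.
exact: cst_continuous.
Qed.

Lemma continuous_dominated0 {R : realType} {W : normedModType R}
    (f g : W -> R) (p : W) :
    (forall q, `|f q| <= `|g q|) -> {for p, continuous g} -> g p = 0 ->
  {for p, continuous f}.
Proof.
move=> fg gc g0.
have f0 : f p = 0 by apply/eqP; rewrite -normr_le0 (le_trans (fg p))// g0 normr0.
apply/cvgrPdist_lt => e e0; move/cvgrPdist_lt : gc => /(_ _ e0).
by apply: filterS => q; rewrite f0 g0 !sub0r !normrN; exact: le_lt_trans.
Qed.

Section Radial.
Context {R : realType}.
Implicit Types (p v : 'rV[R]_3) (i j : 'I_3).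

Definition radius p : R := Num.sqrt (\sum_i p 0 i ^+ 2).

Lemma radius_ge0 p : 0 <= radius p.
Proof. exact: sqrtr_ge0. Qed.

Lemma sqr_radius p : radius p ^+ 2 = \sum_i p 0 i ^+ 2.
Proof. by rewrite sqr_sqrtr// sumr_ge0// => i _; exact: sqr_ge0. Qed.

Lemma coord_le_radius p i : `|p 0 i| <= radius p.
Proof.
rewrite -sqrtr_sqr ler_sqrt ?sumr_ge0//; last by move=> j _; exact: sqr_ge0.
by rewrite (bigD1 i)//= lerDl sumr_ge0// => j _; exact: sqr_ge0.
Qed.

Lemma coord_le_norm p i : `|p 0 i| <= `|p|.
Proof.
rewrite [leRHS]mx_normrE.
exact: (@le_bigmax _ _ _ 0 (fun ij => `|p ij.1 ij.2|) (0, i)).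
Qed.

Lemma radius0 : radius 0 = 0.
Proof. by rewrite /radius big1 ?sqrtr0// => i _; rewrite mxE expr0n. Qed.

Lemma radius_eq0 p : radius p = 0 -> p = 0.
Proof.
move=> r0; apply/rowP => i; apply/eqP; rewrite mxE -normr_le0 -r0.
exact: coord_le_radius.
Qed.

Lemma differentiable_sqr_radius p :
  differentiable (fun q : 'rV[R]_3 => \sum_i q 0 i ^+ 2) p.
Proof.
rewrite (_ : (fun q => _) = \sum_i (fun q : 'rV[R]_3 => q 0 i) ^+ 2).
  apply: differentiable_sum => i; apply: differentiableX.
  exact: differentiable_coord.
by apply/funext => q; rewrite fct_sumE.
Qed.

Lemma continuous_radius : continuous radius.
Proof.
move=> p; apply: continuous_comp; last exact: sqrt_continuous.
exact/differentiable_continuous/differentiable_sqr_radius.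
Qed.

Lemma differentiable_radius p : p != 0 -> differentiable radius p.
Proof.
move=> p0; apply: differentiable_comp; first exact: differentiable_sqr_radius.
apply/derivable1_diffP; apply: ex_derive; apply: is_derive1_sqrt.
rewrite -sqr_radius exprn_gt0// lt_neqAle radius_ge0 andbT eq_sym.
by apply: contra_neq p0; exact: radius_eq0.
Qed.

Lemma derive_coord v p i : 'D_v (fun q : 'rV[R]_3 => q 0 i) p = v 0 i.
Proof.
rewrite /derive; apply: cvg_lim => //.
apply: cvg_near_cst; near=> h.
rewrite /= !mxE addrK /GRing.scale /= mulKf//.
by near: h; exact: nbhs_dnbhs_neq.
Unshelve. all: by end_near. Qed.

(** Differentiate [r^2 = sum x_i^2] and divide by [2 r], which is nonzero here. *)
Lemma derive_radius v p : p != 0 ->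
  'D_v radius p = (\sum_i p 0 i * v 0 i) / radius p.
Proof.
move=> p0.
have r0 : radius p != 0 by apply: contra_neq p0; exact: radius_eq0.
have dr : derivable radius p v by exact/diff_derivable/differentiable_radius.
have : 'D_v (radius ^+ 2) p = 'D_v (fun q : 'rV[R]_3 => \sum_i q 0 i ^+ 2) p.
  by congr ('D_v _ p); apply/funext => q; rewrite -sqr_radius.
rewrite deriveX// [in RHS](_ : (fun q => _) =
    \sum_i (fun q : 'rV[R]_3 => q 0 i) ^+ 2); last first.
  by apply/funext => q; rewrite fct_sumE.
have dc i : derivable (fun q : 'rV[R]_3 => q 0 i) p v.
  exact/diff_derivable/differentiable_coord.
rewrite derive_sum; last by move=> i; exact: derivableX.
under eq_bigr do rewrite deriveX// derive_coord expr1 /GRing.scale/= -mulrA.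
rewrite -mulr_sumr expr1 /GRing.scale/= -mulrA.
move/(mulfI _) => <-; last by rewrite pnatr_eq0.
by rewrite mulrC mulKf.
Qed.

Definition radial_field : vector_field R := fun p => radius p *: p.

Lemma radial_fieldE p i : radial_field p 0 i = radius p * p 0 i.
Proof. exact: mxE. Qed.

(** Division by zero yields 0, so the formula also gives the correct value 0 at the origin. *)
Definition radial_jacobian i j p : R :=
  (i == j)%:R * radius p + p 0 i * p 0 j / radius p.

(** Here [|r x_i| <= r |p|], and [r] tends to 0. *)
Lemma radial_field_diff0 i :
  differentiable (fun q => radial_field q 0 i) 0 /\
  'd (fun q => radial_field q 0 i) 0 = (fun=> 0) :> ('rV[R]_3 -> R).
Proof.
apply: (@diff0_bound _ _ _ radius).
- by rewrite radial_fieldE radius0 mul0r.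
- move=> h; rewrite radial_fieldE normrM ger0_norm ?radius_ge0//.
  by rewrite ler_wpM2l ?radius_ge0// coord_le_norm.
- exact: continuous_radius.
- exact: radius0.
Qed.

Lemma differentiable_radial_field p : differentiable_field radial_field p.
Proof.
move=> i; have [->|p0] := eqVneq p 0; first by have [] := radial_field_diff0 i.
rewrite (_ : (fun q => _) = radius * (fun q : 'rV[R]_3 => q 0 i)).
  by apply: differentiableM;
    [exact: differentiable_radius|exact: differentiable_coord].
by apply/funext => q; exact: radial_fieldE.
Qed.

Lemma dfield_radial j p i :
  dfield (e_ R j) radial_field p 0 i = radial_jacobian i j p.
Proof.
rewrite dfieldE; have [->|p0] := eqVneq p 0.
  have [d0 d0E] := radial_field_diff0 i.
  by rewrite deriveE// d0E /radial_jacobian radius0 invr0 !mulr0 addr0.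
rewrite (_ : (fun q => _) = radius * (fun q : 'rV[R]_3 => q 0 i)); last first.
  by apply/funext => q; exact: radial_fieldE.
rewrite deriveM; first last.
- exact/diff_derivable/differentiable_coord.
- exact/diff_derivable/differentiable_radius.
rewrite derive_coord derive_radius// (bigD1 j)//= big1; last first.
  by move=> k kj; rewrite mxE eqxx (negbTE kj) mulr0.
rewrite !mxE !eqxx /= addr0 mulr1 /radial_jacobian /GRing.scale/=.
by rewrite [_%:R * _]mulrC mulrA.
Qed.

Lemma radial_jacobianC i j p : radial_jacobian i j p = radial_jacobian j i p.
Proof. by rewrite /radial_jacobian eq_sym [p 0 i * _]mulrC. Qed.

(** Holds at the origin too, where [0^-1 = 0]; the trace and Euler identities thus avoid a case
    distinction. *)
Lemma sqr_radiusK p : radius p ^+ 2 / radius p = radius p.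
Proof.
have [->|r0] := eqVneq (radius p) 0; first by rewrite invr0 mulr0.
by rewrite expr2 mulfK.
Qed.

Lemma radial_jacobian_trace p : \sum_i radial_jacobian i i p = 4 * radius p.
Proof.
transitivity (3 * radius p + (\sum_i p 0 i ^+ 2) / radius p).
  by rewrite !big_ord3 /radial_jacobian !eqxx /=; ring.
by rewrite -sqr_radius sqr_radiusK; ring.
Qed.

(* Euler's relation: the field is homogeneous of degree 2. *)
Lemma radial_jacobian_euler p j :
  \sum_i p 0 i * radial_jacobian i j p = 2 * radial_field p 0 j.
Proof.
transitivity (radius p * p 0 j + (\sum_i p 0 i ^+ 2) / radius p * p 0 j).
  rewrite !big_ord3 /radial_jacobian.
  by move: j; apply: ord3P => /=; generalize_entries; intros; ring.
by rewrite -sqr_radius sqr_radiusK radial_fieldE; ring.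
Qed.

Lemma continuous_radial_jacobian i j : continuous (radial_jacobian i j).
Proof.
suff: forall p : 'rV[R]_3, {for p, continuous (radial_jacobian i j)} by [].
move=> p; pose x k : 'rV[R]_3 -> R := fun q => q 0 k.
have cx k : {for p, continuous (x k)} by exact: coord_continuous.
have cr : {for p, continuous radius} by exact: continuous_radius.
apply: (@continuousD _ _ _ (cst (i == j)%:R \* radius)
    (fun q => x i q * x j q / radius q)).
  by apply: continuousM => //; exact: cst_continuous.
have [p0|p0] := eqVneq p 0; last first.
  have r0 : radius p != 0 by apply: contra_neq p0; exact: radius_eq0.
  by apply: continuousM; [exact: continuousM|exact: continuousV].
(* At the origin [x_i x_j / r] is dominated by [x_j], because [|x_i| <= r]. *)
apply: (@continuous_dominated0 _ _ _ (x j)) => // [q|]; last by rewrite /x p0 mxE.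
rewrite mulrAC normrM -[leRHS]mul1r ler_wpM2r//.
rewrite normrM normfV [X in _ / X]ger0_norm ?radius_ge0//.
have [->|r0] := eqVneq (radius q) 0; first by rewrite invr0 mulr0.
by rewrite ler_pdivrMr ?mul1r ?coord_le_radius// lt_neqAle eq_sym r0 radius_ge0.
Qed.

End Radial.

(** * Closedness of exact forms and [C^1] regularity of the radial field *)

Section Regularity.
Context {R : realType}.
Implicit Types (p : 'rV[R]_3) (i j : 'I_3).

Lemma smooth_form_differentiable (a : one_form R) p :
  smooth_form a -> differentiable_field a p.
Proof. by move=> sa i; have [] := sa i 1%N. Qed.

Lemma dfield_dext (f : scalar_field R) i j p :
  dfield (e_ R i) (dext f) p 0 j = partial i (partial j f) p.
Proof.
by rewrite dfieldE /partial; congr ('D_(_) _ _); apply/funext => q; rewrite mxE.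
Qed.

Lemma differentiable_dext (f : scalar_field R) p :
  Ck 2 f -> differentiable_field (dext f) p.
Proof.
move=> [_ f1] i; rewrite (_ : (fun q => _) = partial i f); first by have [] := f1 i.
by apply/funext => q; rewrite mxE.
Qed.

Lemma dfield_dextC (f : scalar_field R) i j p : Ck 2 f ->
  dfield (e_ R i) (dext f) p 0 j = dfield (e_ R j) (dext f) p 0 i.
Proof.
move=> [df f1]; rewrite !dfield_dext; apply: derive_comm.
- by move=> q; exact/diff_derivable.
- by move=> q; exact/diff_derivable.
- by move=> q; apply/diff_derivable; have [] := f1 j.
- by move=> q; apply/diff_derivable; have [] := f1 i.
- by have [_ /(_ i)] := f1 j; apply.
- by have [_ /(_ j)] := f1 i; apply.
Qed.

(** The partial derivatives of [f] and the entries of the bivector are all fixed linear combinations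
    of the components of the field, so this one statement gives both regularity claims. *)
Lemma Ck1_dotv_radial_field (k : 'rV[R]_3) :
  Ck 1 (fun p => dotv (radial_field p) k).
Proof.
have dk q : differentiable_field (fun=> k) q.
  by move=> i; exact: differentiable_cst.
split=> [p|i].
  by apply: differentiable_dotv => //; exact: differentiable_radial_field.
rewrite (_ : partial i _ = \sum_j (cst (k 0 j) * radial_jacobian j i)).
  have c j : continuous (cst (k 0 j) * radial_jacobian j i).
    move=> q; apply: continuousM; first exact: cst_continuous.
    exact: continuous_radial_jacobian.
  by rewrite big_ord3 => q; apply: continuousD; [apply: continuousD|]; exact: c.
apply/funext => p; rewrite fct_sumE /partial derive_dotv//; last first.
  exact: differentiable_radial_field.
rewrite [X in _ + X]big1 ?addr0; last first.
  by move=> j _; rewrite dfieldE derive_cst mulr0.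
by apply: eq_bigr => j _; rewrite dfield_radial mulrC.
Qed.

End Regularity.

(** * The differential equation for [r^3] *)

Section RadialEquation.
Context {R : realType}.
Implicit Types (p : 'rV[R]_3) (i j : 'I_3).

(** This is [r^3]; as a dot product of differentiable fields it obeys the product rule at the origin
    as well. *)
Let f : scalar_field R := fun p => dotv p (radial_field p).

Lemma differentiable_id_field p : differentiable_field id p.
Proof. by move=> i; exact: differentiable_coord. Qed.

(** The product rule gives [V_i] plus [sum_j p_j d_i V_j], and the latter is [2 V_i] by Euler's
    relation. *)
Lemma dext_dotv_radial_field : dext f = fun p => 3 *: radial_field p.
Proof.
apply/funext => p; apply/rowP => i; rewrite !mxE /partial derive_dotv; first last.
- exact: differentiable_radial_field.
- exact: differentiable_id_field.
have -> : dfield (e_ R i) id p = e_ R i.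
  by apply/rowP => j; rewrite dfieldE derive_coord.
rewrite dotvC dotv_e /dotv.
under eq_bigr do rewrite dfield_radial.
by rewrite radial_jacobian_euler radial_fieldE; ring.
Qed.

Lemma Ck2_dotv_radial_field : Ck 2 f.
Proof.
split=> [p|i].
  apply: differentiable_dotv; first exact: differentiable_id_field.
  exact: differentiable_radial_field.
rewrite (_ : partial i f = fun p => dotv (radial_field p) (3 *: e_ R i)).
  exact: Ck1_dotv_radial_field.
apply/funext => p; transitivity (dext f p 0 i); first by rewrite mxE.
rewrite dext_dotv_radial_field mxE -(dotv_e _ i) /dotv mulr_sumr.
by apply: eq_bigr => j _; rewrite !mxE mulrCA.
Qed.

(** As [V = r p], Euler's relation makes [V] an eigenvector of its Jacobian, with eigenvalue
    [2 r]. *)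
Lemma jacobian_radial_field p i :
  \sum_j radial_field p 0 j * radial_jacobian j i p =
  2 * radius p * radial_field p 0 i.
Proof.
under eq_bigr do rewrite radial_fieldE -mulrA.
by rewrite -mulr_sumr radial_jacobian_euler; ring.
Qed.

(** The Hessian is [3 H] with [H V = 2 r V] and [tr H = 4 r], so both terms equal [36 r V]. *)
Lemma radial_equation p :
  dext (eval2 (@canonical_metric R) (dext f) (dext f)) p
  - laplacian f p *: dext f p = 0.
Proof.
have dF : differentiable_field (dext f) p.
  exact/differentiable_dext/Ck2_dotv_radial_field.
have jF i j : dfield (e_ R i) (dext f) p 0 j = 3 * radial_jacobian i j p.
  rewrite -dfield_radial; rewrite dfield_dextC; last exact: Ck2_dotv_radial_field.
  rewrite dext_dotv_radial_field !dfieldE.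
  rewrite (_ : (fun q => _) = 3 *: (fun q => radial_field q 0 i)); last first.
    by apply/funext => q; rewrite mxE.
  by rewrite deriveZ//; apply/diff_derivable/differentiable_radial_field.
have -> : laplacian f p = 12 * radius p.
  rewrite /laplacian; under eq_bigr do rewrite -dfield_dext jF.
  by rewrite -mulr_sumr radial_jacobian_trace; ring.
apply/rowP => i; rewrite eval2_canonical mxE [X in X + _]mxE /partial derive_dotv//.
rewrite dotvC /dotv.
under eq_bigr do rewrite jF {1}dext_dotv_radial_field mxE radial_jacobianC mulrACA.
rewrite -mulr_sumr jacobian_radial_field dext_dotv_radial_field !mxE.
by ring.
Qed.

End RadialEquation.

(** * Jacobi identity and compatibility for the radial field *)

Section RadialPoisson.
Context {R : realType}.
Implicit Types (p : 'rV[R]_3).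

Let pi : contra2 R := fun p => cross_mx (radial_field p).

Lemma dfield_radialC i j p :
  dfield (e_ R i) radial_field p 0 j = dfield (e_ R j) radial_field p 0 i.
Proof. by rewrite !dfield_radial radial_jacobianC. Qed.

Lemma Ck1_cross_radial : Ck_contra2 1 pi.
Proof.
(* By linearity of [cross_mx], the coefficients of an entry are its values on the basis vectors. *)
move=> i j; rewrite (_ : (fun p => _) = fun p => dotv (radial_field p)
  (\row_k cross_mx (e_ R k) i j)).
  exact: Ck1_dotv_radial_field.
apply/funext => p; rewrite /pi /dotv big_ord3 !mxE /=.
by rewrite !big_ord1 !mxE /=; generalize_entries; intros; ring.
Qed.

Lemma is_poisson_cross_radial : is_poisson pi.
Proof.
split; [exact: Ck1_cross_radial|by move=> p; exact: tr_cross_mx|].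
move=> f g h sf sg sh p; rewrite /poisson_bracket.
have dV : forall q, differentiable_field (@radial_field R) q.
  exact: differentiable_radial_field.
have d2 (u : scalar_field R) : smooth u -> differentiable_field (dext u) p.
  by move=> su; exact: differentiable_dext (su 2%N).
have d2C (u : scalar_field R) : smooth u -> forall i j,
    dfield (e_ R i) (dext u) p 0 j = dfield (e_ R j) (dext u) p 0 i.
  by move=> su i j; exact: dfield_dextC (su 2%N).
transitivity (iterated_bracket radial_field (dext f) (dext g) (dext h) p
  + iterated_bracket radial_field (dext g) (dext h) (dext f) p
  + iterated_bracket radial_field (dext h) (dext f) (dext g) p).
  by congr (_ + _ + _); apply: eval2_dext_cross => //; exact: d2.
apply: iterated_bracket_cyclic; [exact: d2C..|].
by move=> i j; exact: dfield_radialC.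
Qed.

Lemma compatible_cross_radial : compatible pi (@canonical_metric R).
Proof.
exists (cross_connection radial_field); split=> [a b c sa sb sc p|a b c sa sb sc p].
  by apply: cross_connection_koszul; [exact: differentiable_radial_field|
    exact: smooth_form_differentiable..].
rewrite Dpi_cross_connection; first last.
- by move=> i j; exact: dfield_radialC.
- exact: smooth_form_differentiable.
- exact: smooth_form_differentiable.
- exact: smooth_form_differentiable.
- exact: differentiable_radial_field.
(* Both [2 H V] and [tr(H) V] are [4 r V]. *)
have -> : compatibility_defect radial_field p = 0.
  apply/rowP => i; rewrite compatibility_defectE dfield_sum; last first.
    exact: differentiable_radial_field.
  under eq_bigr do rewrite dfield_radial radial_jacobianC.
  rewrite jacobian_radial_field /divergence.
  under eq_bigr do rewrite dfield_radial.
  by rewrite radial_jacobian_trace [RHS]mxE; ring.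
by rewrite !dotvE !crossvE !mxE; ring.
Qed.

End RadialPoisson.

Theorem proposition1p2 (R : realType) :
  let f : scalar_field R :=
    fun p => (xc p ^+ 2 + yc p ^+ 2 + zc p ^+ 2) `^ (3 / 2) in
  let pi : contra2 R :=
    fun p => (xc p ^+ 2 + yc p ^+ 2 + zc p ^+ 2) `^ (1 / 2) *: pi_so3 p in
  (Ck 2 f /\
   forall p : 'rV[R]_3,
     dext (eval2 (@canonical_metric R) (dext f) (dext f)) p
     - laplacian f p *: dext f p = 0)
  /\ (is_poisson pi /\ compatible pi (@canonical_metric R)).
Proof.
move=> f pi.
have sqE p : xc p ^+ 2 + yc p ^+ 2 + zc p ^+ 2 = radius p ^+ 2.
  by rewrite sqr_radius big_ord3.
have rE p : (xc p ^+ 2 + yc p ^+ 2 + zc p ^+ 2) `^ 2^-1 = radius p.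
  by rewrite sqE powR12_sqrt ?sqr_ge0// sqrtr_sqr ger0_norm ?radius_ge0.
have -> : f = fun p => dotv p (radial_field p).
  (* The exponent is read as [2^-1 * 3], which turns the real power into the integer power [r^3]. *)
  apply/funext => p; rewrite /f mulrC powRrM rE powR_mulrn ?radius_ge0//.
  rewrite exprSr sqr_radius mulr_suml; apply: eq_bigr => i _.
  by rewrite radial_fieldE; ring.
have -> : pi = fun p => cross_mx (radial_field p).
  apply/funext => p; rewrite /pi div1r rE /pi_so3 /cross_mx !radial_fieldE.
  by rewrite scalerDr scalerBr !scalerA.
split; first by split; [exact: Ck2_dotv_radial_field|exact: radial_equation].
by split; [exact: is_poisson_cross_radial|exact: compatible_cross_radial].
Qed.
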